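(* Let $q$ be a prime power and let $n,d,\ell$ be positive integers with $\ell\ge n$. Then $$A_q^{\mathrm{Lin}}(n,d)=\mathrm{val}\big(\mathrm{KrawtchoukLP}_{\mathrm{Lin}}^{\mathbb{F}_q}(n,d,\ell)\big)^{1/\ell}.$$ More precisely, every $\mathrm{GL}_\ell(\mathbb{F}_q)$-invariant optimum solution of $\mathrm{KrawtchoukLP}_{\mathrm{Lin}}^{\mathbb{F}_q}(n,d,\ell)$ is integral.
   Context: $\mathbb{F}_q$ is the finite field with $q$ elements. For $w\in\mathbb{F}_q^n$, $|w|$ is the Hamming weight (number of nonzero coordinates), and $[d-1]=\{1,\dots,d-1\}$. A linear code of blocklength $n$ is a linear subspace $\mathcal{C}\le\mathbb{F}_q^n$; it has minimum distance at least $d$ if no $w\in\mathcal{C}$ has $|w|\in[d-1]$ (the zero code satisfies this vacuously). $A_q^{\mathrm{Lin}}(n,d)$ is the maximum cardinality of a linear code $\mathcal{C}\le\mathbb{F}_q^n$ of minimum distance at least $d$. For $\alpha\in\mathbb{F}_q^n$, $\chi_\alpha\colon\mathbb{F}_q^n\to\mathbb{C}$ is the additive character associated with $\alpha$, $\chi_\alpha(x)=\exp\big(2\pi i\,\mathrm{Tr}_{\mathbb{F}_q/\mathbb{F}_p}(\sum_k\alpha_kx_k)/p\big)$, where $p$ is the characteristic of $\mathbb{F}_q$. For $\alpha=(\alpha_1,\dots,\alpha_\ell)$ and $x=(x_1,\dots,x_\ell)$ in $(\mathbb{F}_q^n)^\ell$, $\chi_\alpha(x)=\prod_{j=1}^\ell\chi_{\alpha_j}(x_j)$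 and $\mathrm{span}(x)=\mathrm{span}(x_1,\dots,x_\ell)$. $\mathrm{KrawtchoukLP}_{\mathrm{Lin}}^{\mathbb{F}_q}(n,d,\ell)$ is the following linear program in real variables $a_x$, $x\in(\mathbb{F}_q^n)^\ell$: maximize $\sum_{x\in(\mathbb{F}_q^n)^\ell}a_x$ subject to (1) $a_0=1$; (2) $a_{(x_1,\dots,x_\ell)}=0$ whenever there is $w\in\mathrm{span}(x_1,\dots,x_\ell)$ with $|w|\in[d-1]$; (3) $\sum_{x\in(\mathbb{F}_q^n)^\ell}a_x\chi_\alpha(x)\ge0$ for all $\alpha\in(\mathbb{F}_q^n)^\ell$; (4) $a_x=a_{-x}$ for all $x\in(\mathbb{F}_q^n)^\ell$; (5) $a_x\ge0$ for all $x\in(\mathbb{F}_q^n)^\ell$. $\mathrm{val}(\cdot)$ denotes the optimum value of a linear program. The group $\mathrm{GL}_\ell(\mathbb{F}_q)$ acts on $(\mathbb{F}_q^n)^\ell$ by basis change ($M$ sends $(x_1,\dots,x_\ell)$ to the tuple with $j$-th entry $\sum_iM_{ij}x_i$); a solution $a$ is $\mathrm{GL}_\ell(\mathbb{F}_q)$-invariant if it is constant on orbits, equivalently $a_x=a_y$ whenever $\mathrm{span}(x)=\mathrm{span}(y)$. For a linear code $\mathcal{C}\le\mathbb{F}_q^n$, the true solution $a^{\mathcal{C}}$ is given by $a^{\mathcal{C}}_x=1$ if $x_j\in\mathcal{C}$ for all $j\in\{1,\dots,\ell\}$ and $a^{\mathcal{C}}_x=0$ otherwise. A solution $a$ is integral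 if it is a convex combination of true solutions $a^{\mathcal{C}}$, $\mathcal{C}\le\mathbb{F}_q^n$. *)

(* Defs.v *)
From HB Require Import structures.
From mathcomp Require Import all_boot all_order all_algebra all_fingroup all_field.
From mathcomp Require Import all_classical all_reals all_analysis.
From mathcomp.real_closed Require Import complex.

Set Implicit Arguments.
Unset Strict Implicit.
Unset Printing Implicit Defensive.

Import Order.TTheory GRing.Theory Num.Theory.

Local Open Scope ring_scope.
Local Open Scope complex_scope.
Local Open Scope classical_set_scope.

Definition fin_char (F : finFieldType) : nat := s2val (finPcharP F).

Lemma fin_charP (F : finFieldType) : fin_char F \in [pchar F].
Proof. exact: s2valP' (finPcharP F). Qed.

Definition over_prime (F : finFieldType) : splittingFieldType 'F_(fin_char F) :=
  pPrimeCharType (fin_charP F).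

(* [galTrace] takes its values in the line 1%AS of [over_prime F]; the
   coordinate on the vector 1 reads such a value as an element of 'F_p. *)
Definition abs_trace (F : finFieldType) (u : F) : 'F_(fin_char F) :=
  coord [tuple (1 : over_prime F)] ord0
    (galTrace 1 {: over_prime F} (u : over_prime F)).

Definition expi (R : realType) (t : R) : R[i] := cos t +i* sin t.

Definition add_char (R : realType) (F : finFieldType) (n : nat)
    (alpha x : 'rV[F]_n) : R[i] :=
  expi (2 * pi
        * (nat_of_ord (abs_trace (\sum_k alpha 0 k * x 0 k)))%:R
        / (fin_char F)%:R).

(* A tuple (x_1, ..., x_l) of vectors of F^n is the matrix x whose rows are the
   x_j; its span is then the row space of x. *)
Definition tuple_char (R : realType) (F : finFieldType) (n l : nat)
    (alpha x : 'M[F]_(l, n)) : R[i] :=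
  \prod_j add_char R (row j alpha) (row j x).

Definition hweight (F : finFieldType) (n : nat) (w : 'rV[F]_n) : nat :=
  #|[set k | w 0 k != 0]%SET|.

Definition low_weight (F : finFieldType) (n d : nat) (w : 'rV[F]_n) : bool :=
  (1 <= hweight w <= d.-1)%N.

Definition min_dist_ge (F : finFieldType) (n d : nat)
    (C : {vspace 'rV[F]_n}) : Prop :=
  forall w, w \in C -> ~~ low_weight d w.

Definition ALin (F : finFieldType) (n d : nat) : nat :=
  \max_(S : {set 'rV[F]_n} |
      `[< exists2 C : {vspace 'rV[F]_n},
            S = [set w in C]%SET & min_dist_ge d C >]) #|S|.

Definition LPvar (R : realType) (F : finFieldType) (n l : nat) : Type :=
  'M[F]_(l, n) -> R.

Definition objective (R : realType) (F : finFieldType) (n l : nat)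
    (a : LPvar R F n l) : R :=
  \sum_x a x.

(* In the third field the order is that of R[i]: 0 <= z means that z is real
   and nonnegative. *)
Record feasible (R : realType) (F : finFieldType) (n d l : nat)
    (a : LPvar R F n l) : Prop := Feasible {
  feas_norm : a 0 = 1;
  feas_dist : forall x : 'M[F]_(l, n),
    (exists2 w : 'rV[F]_n, (w <= x)%MS & low_weight d w) -> a x = 0;
  feas_four : forall alpha : 'M[F]_(l, n),
    0 <= \sum_x (a x)%:C * tuple_char R alpha x;
  feas_symm : forall x, a x = a (- x);
  feas_nneg : forall x, 0 <= a x }.

Definition LPval (R : realType) (F : finFieldType) (n d l : nat) : \bar R :=
  ereal_sup [set (objective a)%:E | a in [set a : LPvar R F n l | feasible d a]].

Definition optimal (R : realType) (F : finFieldType) (n d l : nat)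
    (a : LPvar R F n l) : Prop :=
  feasible d a /\
  forall b : LPvar R F n l, feasible d b -> objective b <= objective a.

(* The j-th row of M^T *m x is \sum_i M i j *: row i x. *)
Definition GL_invariant (R : realType) (F : finFieldType) (n l : nat)
    (a : LPvar R F n l) : Prop :=
  forall (M : 'M[F]_l) (x : 'M[F]_(l, n)), M \in unitmx -> a (M^T *m x) = a x.

Definition true_solution (R : realType) (F : finFieldType) (n l : nat)
    (C : {vspace 'rV[F]_n}) : LPvar R F n l :=
  fun x => ([forall j, row j x \in C])%:R.

Definition integral_solution (R : realType) (F : finFieldType) (n l : nat)
    (a : LPvar R F n l) : Prop :=
  exists (m : nat) (C : 'I_m -> {vspace 'rV[F]_n}) (w : 'I_m -> R),
    [/\ forall i, 0 <= w i,
        \sum_i w i = 1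
      & forall x, a x = \sum_i w i * true_solution R (C i) x].

(* Main.v *)
(** Let [k] be the largest dimension of a linear code of distance at least [d]
   and let [q] be the size of the field. For [k <= n <= l] there is a maximum
   rank distance (Gabidulin) code: an F-linear space of [q^(kl)] matrices whose
   nonzero elements have rank greater than [n - k]. By duality no nonzero [x] of
   rank at most [k] is orthogonal to it, while a feasible [a] vanishes on
   matrices of rank greater than [k]; so Poisson summation says that the Fourier
   transform of [a] sums to exactly [q^(kl)] over the code. Its terms are
   nonnegative and the term at 0 is the objective, which gives the bound
   [q^(kl)], attained by a true solution. At an optimum all other terms vanish,
   and as every matrix of rank greater than [n - k] lies in some such code, the
   transform of [a] vanishes on all of them. Finally, an invariant [a] is a
   signed combination [sum_C w_C a^C]; evaluating the transform at a tuple that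
   spans the orthogonal of [C] gives, by induction on [dim C], that [w_C = 0]
   when [dim C < k], and then [w_C] is the value of [a] at a tuple spanning [C]
   when [dim C = k]. *)
Require Import Defs.
From HB Require Import structures.
From mathcomp Require Import all_boot all_order all_algebra all_fingroup all_field.
From mathcomp Require Import all_classical all_reals all_analysis.
From mathcomp.real_closed Require Import complex.
From mathcomp Require Import zify.

Set Implicit Arguments.
Unset Strict Implicit.
Unset Printing Implicit Defensive.

Import Order.TTheory GRing.Theory Num.Theory.

Local Open Scope ring_scope.
Local Open Scope complex_scope.

(** * Gabidulin codes *)

(* The extension is the splitting field of X^N - X with N = q^l, whose elements
   are exactly the N roots. *)
Lemma fin_ext_of_degree (F : finFieldType) (l : nat) :
  (0 < l)%N -> exists K : fieldExtType F, \dim {:K} = l.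
Proof.
move=> l_gt0; set N := (#|F| ^ l)%N.
have N_gt1 : (1 < N)%N.
  by rewrite -(expn0 #|F|) ltn_exp2l // finNzRing_gt1.
have szq (A : nzRingType) : size ('X^N - 'X : {poly A}) = N.+1.
  by rewrite size_polyDl size_polyXn // size_polyN size_polyX.
have nz_q : ('X^N - 'X : {poly F}) != 0 by rewrite -size_poly_eq0 szq.
have [L [zs DqL defL]] := FinSplittingFieldFor nz_q.
exists L.
have EqL : map_poly (in_alg L) ('X^N - 'X) = 'X^N - 'X.
  by rewrite rmorphB /= map_polyXn map_polyX.
rewrite EqL in DqL.
have N0 : N%:R = 0 :> L.
  have [p pr_p pcharF] := finPcharP F.
  have pcharL : p \in [pchar L] by rewrite pchar_lalg.
  apply/eqP; rewrite -(dvdn_pcharf pcharL) /N (card_pprimeChar pcharF).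
  rewrite -expnM dvdn_exp // muln_gt0 l_gt0 andbT lt0n.
  apply: contraTneq (finNzRing_gt1 F) => e0.
  by rewrite (card_pprimeChar pcharF) e0.
(* The derivative of X^N - X is -1 because N vanishes in [L], so no root is repeated. *)
have Uzs : uniq zs.
  rewrite -separable_prod_XsubC -(eqp_separable DqL) unlock.
  rewrite derivB derivXn derivX -scaler_nat N0 scale0r sub0r.
  by rewrite -[- 1]scaleN1r coprimepZr ?oppr_eq0 ?oner_eq0 // coprimep1.
have /finField_galois_generator[/= a _ Da]: (1 <= {:L})%VS by apply: sub1v.
rewrite dimv1 expn1 in Da.
have zsE z : (z \in zs) = (z == z ^+ N).
  rewrite -root_prod_XsubC -(eqp_root DqL) /root !hornerE subr_eq0.
  by rewrite eq_sym.
have aXE z : (a ^+ l)%g z = z ^+ N.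
  rewrite /N; elim: (l) => [|i IHi]; first by rewrite gal_id.
  by rewrite expgSr expnSr exprM galM ?memvf // IHi Da ?memvf.
(* With [a] the q-power Frobenius, the roots form the fixed field of [a ^+ l]; being a subfield that
   generates [L], they are all of [L]. *)
have zs_fix : zs =i fixedSpace (a ^+ l)%g.
  by move=> z; rewrite zsE (sameP fixedSpaceP eqP) aXE eq_sym.
have in_zs z : z \in zs.
  suff defE : fixedSpace (a ^+ l)%g = {:L}%VS by rewrite zs_fix defE memvf.
  apply/eqP; rewrite eqEsubv subvf /= -[X in (X <= _)%VS]defL.
  rewrite -[fixedSpace _]subfield_closed agenvS //.
  by rewrite subv_add sub1v; apply/span_subvP=> y; rewrite zs_fix.
have szs : size zs = N.
  by apply: succn_inj; rewrite -(size_prod_XsubC _ id) -(eqp_size DqL) szq.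
apply/eqP; rewrite -(eqn_exp2l _ _ (finNzRing_gt1 F)); apply/eqP.
have := card_vspace (fullv : {vspace finvect_type L}).
rewrite card_vspacef => <-; rewrite -/N -szs.
pose zs' : seq (finvect_type L) := zs.
rewrite -[size zs]/(size zs') -(card_uniqP (Uzs : uniq zs')).
by apply/esym/eq_card => z; apply: in_zs.
Qed.

Lemma big_rowspace (F : finFieldType) (S : Type) (idx : S)
    (op : Monoid.com_law idx) (l m n : nat) (C : 'M[F]_(m, n))
    (g : 'M[F]_(l, n) -> S) :
  \big[op/idx]_(x | (x <= C)%MS) g x
    = \big[op/idx]_(c : 'M[F]_(l, \rank C)) g (c *m row_base C).
Proof.
rewrite (reindex_onto (fun c => c *m row_base C) (fun x => x *m pinvmx (row_base C))).
  apply: eq_bigl => c; rewrite mulmxKp ?row_base_free // eqxx andbT.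
  by rewrite (submx_trans (submxMl _ _)) // eq_row_base.
by move=> x xC; rewrite mulmxKpV // eq_row_base.
Qed.

Lemma card_rowspace (F : finFieldType) (m n : nat) (C : 'M[F]_(m, n)) :
  #|[set v : 'rV[F]_n | (v <= C)%MS]%SET| = (#|F| ^ \rank C)%N.
Proof.
rewrite -sum1_card (eq_bigl (fun v : 'rV_n => (v <= C)%MS)) => [|v]; last by rewrite inE.
by rewrite big_rowspace sum1_card card_mx mul1n.
Qed.

Section Linearized.
Import VectorInternalTheory.
Variables (F : finFieldType) (K : fieldExtType F).
Local Notation q := #|F|.

Definition linearized (k : nat) (u : 'I_k -> K) : {poly K} :=
  \sum_(j < k) u j *: 'X^(q ^ j).

Lemma horner_linearized k (u : 'I_k -> K) z :
  (linearized u).[z] = \sum_(j < k) u j * z ^+ (q ^ j).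
Proof.
by rewrite horner_sum; apply: eq_bigr => j _; rewrite hornerZ hornerXn.
Qed.

Lemma frobD (j : nat) (x y : K) :
  (x + y) ^+ (q ^ j) = x ^+ (q ^ j) + y ^+ (q ^ j).
Proof.
have [p _ pcharF] := finPcharP F.
have pcharK : p \in [pchar K] by rewrite pchar_lalg.
apply: (exprDn_pchar (n := q ^ j) _ _ _); rewrite (card_pprimeChar pcharF).
by rewrite -expnM pnatX pnatE ?(pcharf_prime pcharF) // pcharK.
Qed.

Lemma frobZ (j : nat) (a : F) (x : K) : (a *: x) ^+ (q ^ j) = a *: x ^+ (q ^ j).
Proof.
rewrite exprZn; congr (_ *: _).
by elim: j => [|j IHj]; rewrite ?expr1 // expnSr exprM IHj expf_card.
Qed.

Lemma linearized_linear k (u : 'I_k -> K) : linear (horner (linearized u)).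
Proof.
move=> a x y; rewrite !horner_linearized scaler_sumr -big_split /=.
by apply: eq_bigr => j _; rewrite frobD frobZ mulrDr scalerAr.
Qed.

Lemma coef_linearized k (u : 'I_k -> K) (j : 'I_k) : (linearized u)`_(q ^ j) = u j.
Proof.
rewrite coef_sum (bigD1 j) //= coefZ coefXn eqxx mulr1 big1 ?addr0 // => i /negPf nij.
by rewrite coefZ coefXn eqn_exp2l ?finNzRing_gt1 // val_eqE eq_sym nij mulr0.
Qed.

Lemma size_linearized k (u : 'I_k -> K) m :
    (forall j : 'I_k, (m < j)%N -> u j = 0) ->
  (size (linearized u) <= (q ^ m).+1)%N.
Proof.
move=> u0; rewrite (leq_trans (size_sum _ _ _)) //; apply/bigmax_leqP => j _.
have [/u0->|le_jm] := ltnP m j; first by rewrite scale0r size_poly0.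
rewrite (leq_trans (size_scale_leq _ _)) //.
by rewrite size_polyXn ltnS leq_exp2l ?finNzRing_gt1.
Qed.

(** A nonzero polynomial of degree at most q^m has at most q^m roots, and [f] sends distinct vectors
    to distinct points. Taking m below k - 1 gives the sharper bound needed for codewords of
    prescribed rank. *)
Lemma card_linearized_roots k (u : 'I_k -> K) m (i : 'I_k) n
    (f : {linear 'rV[F]_n -> K}) :
    u i != 0 -> (forall j : 'I_k, (m < j)%N -> u j = 0) -> injective f ->
  (#|[set v | root (linearized u) (f v)]%SET| <= q ^ m)%N.
Proof.
set S := [set v | _]%SET => ui_neq0 u0 f_inj.
have nzP : linearized u != 0.
  by apply: contraNneq ui_neq0 => P0; rewrite -coef_linearized P0 coef0.
have := max_poly_roots nzP (rs := [seq f v | v <- enum S]).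
rewrite size_map -cardE map_inj_uniq // enum_uniq => lt_rs.
rewrite -ltnS (leq_trans (lt_rs _ _) (size_linearized u0)) //.
by apply/allP=> _ /mapP[v vS ->]; rewrite mem_enum inE in vS.
Qed.

(* A matrix of the code is the F-linear map induced on an n-dimensional subspace
   of K by a linearized polynomial of q-degree less than k, whose kernel has
   dimension less than k by root counting. An element of exact rank r comes from
   a polynomial of q-degree at most n - r that vanishes on n - r of the basis
   vectors: that many linear equations for one more unknown. *)
Lemma gabidulin_code n k : (k <= n <= dim K)%N ->
  exists enc : {linear 'M[F]_(k, dim K) -> 'M[F]_(n, dim K)},
    (forall c, c != 0 -> (n - k < \rank (enc c))%N) /\
    (forall r, (n - k < r <= n)%N -> exists c, \rank (enc c) = r).
Proof.
move=> /andP[le_kn le_n].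
(* Padding coordinates with zeros realizes F^n as an n-dimensional subspace of [K]. *)
pose ev (v : 'rV[F]_n) : K := r2v (v *m pid_mx n).
have ev_linear : linear ev.
  by move=> a x y; rewrite /ev mulmxDl -scalemxAl linearP.
pose evM := GRing.isLinear.Build _ _ _ _ ev ev_linear.
pose evL : {linear 'rV[F]_n -> K} := HB.pack ev evM.
have ev_inj : injective evL.
  move=> x y /(congr1 v2r); rewrite /= /ev !r2vK => exy.
  rewrite -[x]mulmx1 -[y]mulmx1 -pid_mx_1 -(pid_mx_id F n n le_n).
  by rewrite !mulmxA exy.
pose coefs (c : 'M[F]_(k, dim K)) (j : 'I_k) : K := r2v (row j c).
pose act c (v : 'rV[F]_n) : 'rV[F]_(dim K) := v2r (linearized (coefs c)).[ev v].
have act_linear c : linear (act c).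
  by move=> a x y; rewrite /act ev_linear linearized_linear linearP.
pose enc c : 'M[F]_(n, dim K) := lin1_mx (act c).
have encE c v : v *m enc c = act c v.
  pose actM := GRing.isLinear.Build _ _ _ _ (act c) (act_linear c).
  pose actL : {linear 'rV[F]_n -> 'rV[F]_(dim K)} := HB.pack (act c) actM.
  exact: (mul_rV_lin1 actL).
have enc_linear : linear enc.
  move=> a c c'; apply/row_matrixP => i; rewrite !rowE mulmxDr -scalemxAr !encE /act.
  rewrite -linearP !horner_linearized scaler_sumr -big_split; congr v2r.
  apply: eq_bigr => j _ /=.
  by rewrite /coefs [row j _]linearP linearP mulrDl scalerAl.
pose encM := GRing.isLinear.Build _ _ _ _ enc enc_linear.
pose encL : {linear 'M[F]_(k, dim K) -> 'M[F]_(n, dim K)} := HB.pack enc encM.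
(* The kernel of [enc c] corresponds to the roots in the subspace; having at most q^m elements, it
   has dimension at most m. *)
have rank_enc c i m : coefs c i != 0 -> (forall j : 'I_k, (m < j)%N -> coefs c j = 0) ->
    (n <= \rank (enc c) + m)%N.
  move=> ci_neq0 c0.
  have := card_linearized_roots ci_neq0 c0 ev_inj.
  rewrite (_ : [set v | _]%SET = [set v : 'rV[F]_n | (v <= kermx (enc c))%MS]%SET); last first.
    apply/setP => v; rewrite !inE /root.
    by rewrite -(inj_eq (can_inj (@v2rK F K))) linear0 sub_kermx encE.
  by rewrite card_rowspace mxrank_ker leq_exp2l ?finNzRing_gt1 // leq_subLR.
have nz_coefs c : c != 0 -> exists i, coefs c i != 0.
  move=> c_neq0; apply/existsP; apply: contraNT c_neq0; rewrite negb_exists.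
  move=> /forallP c0; apply/eqP/row_matrixP => i; rewrite row0.
  by apply: (can_inj (@r2vK F K)); rewrite linear0; apply/eqP/negPn/c0.
exists encL; split=> [c /nz_coefs[i ci_neq0] | r /andP[lt_r le_r]].
  have : (k.-1 < k)%N by case: (k) i {ci_neq0} => [[]|].
  suff : (n <= \rank (enc c) + k.-1)%N.
    by rewrite -[encL c]/(enc c); move: (\rank _) => rk; lia.
  by apply: rank_enc ci_neq0 _ => j; have := ltn_ord j; lia.
set s := (n - r)%N; have lt_sk : (s < k)%N by rewrite /s; lia.
have le_sn : (s <= n)%N by rewrite /s; lia.
pose b (i : 'I_s) : K := ev (delta_mx 0 (widen_ord le_sn i)).
(* A Moore matrix with one more row than columns; a nonzero vector of its left kernel lists the
   coefficients of the wanted polynomial. *)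
pose N : 'M[K]_(s.+1, s) := \matrix_(j, i) b i ^+ (q ^ j).
have [u uN u_neq0] : exists2 u : 'rV[K]_s.+1, u *m N = 0 & u != 0.
  have : kermx N != 0.
    by rewrite -mxrank_eq0 mxrank_ker subn_eq0 -ltnNge ltnS rank_leq_col.
  by case/rowV0Pn=> u /sub_kermxP uN u_neq0; exists u.
pose c : 'M[F]_(k, dim K) :=
  \matrix_j (if (j <= s)%N then v2r (u 0 (inord j)) else 0).
have coefsE j : coefs c j = if (j <= s)%N then u 0 (inord j) else 0.
  by rewrite /coefs rowK; case: ifP => _; rewrite ?v2rK ?linear0.
have le_rank : (n <= \rank (enc c) + s)%N.
  have /rV0Pn[j uj_neq0] := u_neq0.
  apply: (rank_enc c (widen_ord lt_sk j)) => [|i lt_si].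
    by rewrite coefsE /= -ltnS ltn_ord inord_val.
  by rewrite coefsE leqNgt lt_si.
have rows0 (i : 'I_n) : (i < s)%N -> row i (enc c) = 0.
  move=> lt_is; rewrite rowE encE /act horner_linearized.
  have /matrixP/(_ 0 (Ordinal lt_is)) := uN; rewrite !mxE => uN0.
  rewrite -[RHS](linear0 v2r) -[in RHS]uN0; congr v2r.
  rewrite (bigID (fun j : 'I_k => (j < s.+1)%N)) /= [X in _ + X]big1 ?addr0.
    rewrite (big_ord_narrow lt_sk); apply: eq_bigr => j _.
    rewrite mxE coefsE /= -ltnS ltn_ord inord_val.
    by rewrite /b (_ : widen_ord _ _ = i) //; apply: val_inj.
  by move=> j; rewrite coefsE ltnS => /negPf->; rewrite mul0r.
exists c; rewrite -[encL c]/(enc c); apply/eqP; rewrite eqn_leq andbC.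
apply/andP; split; first by move: le_rank; rewrite /s; move: (\rank _) => rk; lia.
(* Since the first s rows vanish, the rank is at most n - s = r. *)
have -> : enc c = copid_mx s *m enc c.
  suff pid0 : (pid_mx s : 'M[F]_n) *m enc c = 0 by rewrite mulmxBl mul1mx pid0 subr0.
  apply/row_matrixP => i; rewrite row_mul row0.
  have [lt_is|le_si] := ltnP i s.
    suff -> : row i (pid_mx s : 'M[F]_n) = delta_mx 0 i by rewrite -rowE rows0.
    by apply/rowP => j; rewrite !mxE eqxx lt_is andbT eq_sym.
  suff -> : row i (pid_mx s : 'M[F]_n) = 0 by rewrite mul0mx.
  by apply/rowP => j; rewrite !mxE ltnNge le_si andbF.
rewrite (leq_trans (mxrankM_maxl _ _)) // rank_copid_mx //.
by rewrite /s; lia.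
Qed.
End Linearized.

Lemma mulmx_equiv_rank (F : fieldType) (m n : nat) (A B : 'M[F]_(m, n)) :
  \rank A = \rank B ->
  exists (P : 'M[F]_m) (Q : 'M[F]_n),
    [/\ P \in unitmx, Q \in unitmx & P *m B *m Q = A].
Proof.
move=> eAB.
exists (col_ebase A *m invmx (col_ebase B)), (invmx (row_ebase B) *m row_ebase A).
split; try by rewrite unitmx_mul unitmx_inv ?col_ebase_unit ?row_ebase_unit.
rewrite -{2}(mulmx_ebase B) -{3}(mulmx_ebase A) eAB !mulmxA.
by rewrite mulmxKV ?col_ebase_unit // mulmxK ?row_ebase_unit.
Qed.

(** The Gabidulin code is transposed to get l by n matrices. Invertible factors on both sides keep
    all ranks and can carry a codeword with the rank of [A] onto [A]. *)
Lemma mrd_code (F : finFieldType) (l n k : nat) (A : 'M[F]_(l, n)) :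
    (0 < l)%N -> (k <= n <= l)%N ->
  exists enc : {linear 'M[F]_(k, l) -> 'M[F]_(l, n)},
    (forall c, c != 0 -> (n - k < \rank (enc c))%N) /\
    ((n - k < \rank A)%N -> exists c, enc c = A).
Proof.
move=> l_gt0 le_knl; have [K] := fin_ext_of_degree F l_gt0.
rewrite dimvf => dimK; subst l.
have [enc [rank_enc encP]] := @gabidulin_code F K n k le_knl.
have [P [Q [uP uQ PQ]]] : exists (P : 'M[F]_(_)) (Q : 'M[F]_n),
    [/\ P \in unitmx, Q \in unitmx &
        (n - k < \rank A)%N -> exists c, P *m (enc c)^T *m Q = A].
  have [lt_r|_] := ltnP (n - k) (\rank A); last first.
    by exists 1%:M, 1%:M; rewrite !unitmx1.
  have [|c rank_c] := encP (\rank A); first by rewrite lt_r rank_leq_col.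
  rewrite -mxrank_tr in rank_c.
  have [P [Q [uP uQ PQ]]] := mulmx_equiv_rank (esym rank_c).
  by exists P, Q; split=> // _; exists c.
pose f c := P *m (enc c)^T *m Q.
have f_linear : linear f.
  by move=> a c c'; rewrite /f linearP /= linearP /= mulmxDr mulmxDl -scalemxAr -scalemxAl.
pose fM := GRing.isLinear.Build _ _ _ _ f f_linear.
pose fL : {linear 'M[F]_(k, _) -> 'M[F]_(_, n)} := HB.pack f fM.
exists fL; split=> //= c /rank_enc.
by rewrite /f mxrankMfree ?row_free_unit // eqmxMfull ?row_full_unit // mxrank_tr.
Qed.

(** * The Fourier transform of a solution *)

Section Character.
Variables (R : realType) (F : finFieldType).
Local Notation p := (fin_char F).

Lemma fin_char_prime : prime p.
Proof. exact: pcharf_prime (fin_charP F). Qed.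

Lemma expiD (s t : R) : expi (s + t) = expi s * expi t.
Proof.
rewrite /expi cosD sinD; apply/eqP; rewrite eq_complex /= eqxx addrC /=.
by rewrite mulrC [X in _ + X]mulrC.
Qed.

Lemma expi_period (t : R) n : expi (t + (pi *+ 2) *+ n) = expi t.
Proof. by rewrite /expi (periodicn (@cosD2pi R)) (periodicn (@sinD2pi R)). Qed.

(** The real part is 1 - 2 sin^2(t/2), and t/2 lies strictly between 0 and pi. *)
Lemma expi_neq1 (t : R) : 0 < t < pi *+ 2 -> expi t != 1.
Proof.
move=> /andP[t_gt0 t_lt]; rewrite eq_complex /= negb_and; apply/orP; left.
have -> : t = (t / 2) *+ 2 by rewrite -mulr_natr divfK.
rewrite cos_mulr2n cos2sin2 mulrnBl mulr2n addrAC addrK.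
rewrite subr_eq addrC -subr_eq subrr eq_sym mulrn_eq0 /= expf_eq0 /= gt_eqF //.
by apply: sin_gt0_pi; rewrite divr_gt0 //= ltr_pdivrMr // mulrDr mulr1 -mulr2n.
Qed.

Lemma abs_traceD (u v : F) : abs_trace (u + v) = abs_trace u + abs_trace v.
Proof. by rewrite /abs_trace raddfD raddfD. Qed.

(** By linear independence of the automorphisms, their sum, the trace, is not the zero map; its
    values lie on the line of 1, so the coordinate loses nothing. *)
Lemma abs_trace_neq0 : exists u : F, abs_trace u != 0.
Proof.
pose L := over_prime F.
have [u _ tr_neq0] : exists2 u : L, u \in {:L}%VS & galTrace 1 {:L} u != 0.
  have := @gal_independent_contra _ L {:L} [in 'Gal({:L} / 1)%g] (fun=> 1) 1%g.
  case=> [||u uL]; rewrite ?group1 ?oner_neq0 //.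
  by under eq_bigr do rewrite mul1r; exists u.
exists u.
have gal1 : galois 1 {:L} by apply: finField_galois; apply: sub1v.
have /vlineP[k tr_k] := mem_galTrace gal1 (memvf u).
have free1 : free [tuple (1 : L)] by rewrite free_cons span_nil memv0 oner_neq0 nil_free.
rewrite /abs_trace -/L tr_k linearZ /= (coord_free ord0 ord0 free1) mulr1.
by apply: contraNneq tr_neq0 => k0; rewrite tr_k k0 scale0r.
Qed.

Definition trace_char (u : F) : R[i] :=
  expi (2 * pi * (nat_of_ord (abs_trace u))%:R / p%:R).

Lemma trace_charE u : trace_char u = expi ((pi *+ 2) / p%:R *+ abs_trace u).
Proof. by rewrite /trace_char mulr_natl -mulrA mulrCA mulr_natl. Qed.

Lemma trace_char0 : trace_char 0 = 1.
Proof.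
have tr0 : nat_of_ord (abs_trace (0 : F)) = 0%N by rewrite /abs_trace !raddf0.
by rewrite trace_charE tr0 mulr0n /expi cos0 sin0.
Qed.

Lemma trace_charD u v : trace_char (u + v) = trace_char u * trace_char v.
Proof.
have p_gt0 := prime_gt0 fin_char_prime.
rewrite !trace_charE -expiD -mulrnDr abs_traceD.
set a := abs_trace u; set b := abs_trace v.
(* The multiple of p dropped by the reduction contributes only whole turns. *)
have -> : nat_of_ord (a + b) = ((a + b) %% p)%N.
  by congr (_ %% _)%N; apply: Fp_cast fin_char_prime.
rewrite {2}(divn_eq (a + b) p) mulrnDr addrC.
rewrite mulnC mulrnA -[(pi *+ 2) / _ *+ p]mulr_natr divfK ?expi_period //.
by rewrite pnatr_eq0 -lt0n.
Qed.

Lemma trace_char_neq1 : exists u, trace_char u != 1.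
Proof.
have [u tr_neq0] := abs_trace_neq0; exists u; rewrite trace_charE expi_neq1 //.
have p_gt0 := prime_gt0 fin_char_prime.
have pi2_gt0 : 0 < pi *+ 2 :> R by rewrite pmulrn_lgt0 // pi_gt0.
rewrite -mulr_natr pmulr_lgt0 ?divr_gt0 ?ltr0n ?lt0n //=.
rewrite mulrAC ltr_pdivrMr ?ltr0n // ltr_pM2l // ltr_nat.
  have := ltn_ord (abs_trace u); move/leq_trans; apply; rewrite (Fp_cast fin_char_prime).
  exact: leqnn.
by rewrite -lt0n.
Qed.

Lemma tuple_charE n l (alpha x : 'M[F]_(l, n)) :
  tuple_char R alpha x = trace_char (\tr (alpha *m x^T)).
Proof.
rewrite /tuple_char /mxtrace.
rewrite (big_morph trace_char trace_charD trace_char0).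
apply: eq_bigr => j _; rewrite /add_char -/(trace_char _) mxE; congr trace_char.
by apply: eq_bigr => k _; rewrite !mxE.
Qed.
End Character.

Lemma mxtrace_nondegenerate (F : fieldType) (m n : nat) (Z : 'M[F]_(m, n)) :
  Z != 0 -> exists Y : 'M[F]_(n, m), \tr (Y *m Z) != 0.
Proof.
case/matrix0Pn => i [j Zij_neq0]; exists (delta_mx j i).
rewrite mxtrace_mulC /mxtrace (bigD1 i) //= big1 => [|i' ni].
  rewrite addr0 mxE (bigD1 j) //= big1 => [|j' nj]; rewrite !mxE.
    by rewrite !eqxx mulr1 addr0.
  by rewrite (negPf nj) mulr0.
by rewrite mxE big1 // => j' _; rewrite mxE (negPf ni) andbF mulr0.
Qed.

Lemma mulmx_tr_eq0 (F : fieldType) (l m n : nat) (X : 'M[F]_(l, n)) (A : 'M[F]_(m, n)) :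
  (X *m A^T == 0) = (A <= kermx X^T)%MS.
Proof. by rewrite sub_kermx -trmx_eq0 trmx_mul trmxK. Qed.

(** With [x] factored as [A *m B], the products of codewords with [B^T] fill all l by k matrices, so
    their pairing with the nonzero [A] cannot vanish throughout. *)
Lemma mrd_dual (F : finFieldType) (l n k : nat)
    (enc : {linear 'M[F]_(k, l) -> 'M[F]_(l, n)}) (x : 'M[F]_(l, n)) :
    (k <= n)%N -> (forall c, c != 0 -> (n - k < \rank (enc c))%N) ->
    x != 0 -> (\rank x <= k)%N ->
  exists c, \tr (enc c *m x^T) != 0.
Proof.
move=> le_kn rank_enc x_neq0 le_xk.
(* The inner dimension is k even if the rank of [x] is smaller, so that [B] has full row rank k and
   [phi] maps between spaces of equal size. *)
pose A := col_ebase x *m pid_mx (\rank x) : 'M[F]_(l, k).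
pose B := pid_mx k *m row_ebase x : 'M[F]_(k, n).
have xE : x = A *m B.
  rewrite -[LHS]mulmx_ebase /A /B !mulmxA -[in RHS](mulmxA (col_ebase x)).
  by rewrite mul_pid_mx (minn_idPl le_xk) (minn_idPr le_xk).
have rankB : \rank B = k.
  by rewrite /B mxrankMfree ?row_free_unit ?row_ebase_unit // rank_pid_mx.
have A_neq0 : A != 0 by apply: contraNneq x_neq0 => A0; rewrite xE A0 mul0mx.
pose phi c := enc c *m B^T.
(* If phi c = 0 then enc c has rank at most n - k; phi is then onto as its source
   and target have the same cardinality. *)
have phi_inj : injective phi.
  move=> c c' eq_phi.
  have phi0 : enc (c - c') *m B^T = 0.
    by rewrite linearB /= mulmxBl -/(phi c) eq_phi subrr.
  apply/eqP; rewrite -subr_eq0; apply/negPn/negP => /rank_enc.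
  by have := mulmx0_rank_max phi0; rewrite mxrank_tr rankB; move: (\rank _) => rk; lia.
have [g _ gK] : bijective phi.
  by apply: inj_card_bij => //; rewrite !card_mx mulnC.
have [Y trY_neq0] : exists Y, \tr (Y *m A^T) != 0.
  by apply: mxtrace_nondegenerate; rewrite trmx_eq0.
by exists (g Y); rewrite xE trmx_mul mulmxA -/(phi (g Y)) gK.
Qed.

Section Fourier.
Variables (R : realType) (F : finFieldType).
Local Notation psi := (@trace_char R F).

Lemma sum_trace_char_scalar m n (f : 'M[F]_(m, n) -> F) : scalar f ->
  \sum_v psi (f v) = if [forall v, f v == 0] then (#|F| ^ (m * n))%:R else 0.
Proof.
move=> f_lin; case: ifPn => [/forallP f0 | ].
  rewrite (eq_bigr (fun=> 1)) => [|v _]; last by rewrite (eqP (f0 v)) trace_char0.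
  by rewrite sumr_const card_mx.
rewrite negb_forall => /existsP[v0 fv0_neq0].
have [u psi_neq1] := trace_char_neq1 R F.
set S := \sum_v _.
have : S = psi u * S.
  (* Translation by a vector where [f] equals [u] multiplies the sum by [psi u], which is not 1. *)
  rewrite {1}/S (reindex_inj (addrI ((u / f v0) *: v0))) /= mulr_sumr.
  by apply: eq_bigr => v _; rewrite f_lin divfK // trace_charD.
move/eqP; rewrite -subr_eq0 -{1}[S]mul1r -mulrBl mulf_eq0 subr_eq0 eq_sym.
by rewrite (negPf psi_neq1) => /eqP.
Qed.

Definition fourier n l (a : LPvar R F n l) (alpha : 'M[F]_(l, n)) : R[i] :=
  \sum_x (a x)%:C * tuple_char R alpha x.

Lemma fourier0 n l (a : LPvar R F n l) : fourier a 0 = (objective a)%:C.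
Proof.
rewrite /fourier /objective rmorph_sum; apply: eq_bigr => x _.
by rewrite tuple_charE mul0mx mxtrace0 trace_char0 mulr1.
Qed.

(** In coordinates on the row space the character is [psi] of a linear form, which is zero exactly
    when [alpha] is orthogonal to [C]. *)
Lemma fourier_rowspace m n l (C : 'M[F]_(m, n)) alpha :
  fourier (fun x : 'M[F]_(l, n) => (x <= C)%MS%:R) alpha =
    if alpha *m C^T == 0 then (#|F| ^ (l * \rank C))%:R else 0.
Proof.
rewrite /fourier (eq_bigr (fun x => if (x <= C)%MS then tuple_char R alpha x else 0)).
  rewrite -big_mkcond big_rowspace.
  under eq_bigr do rewrite tuple_charE.
  rewrite sum_trace_char_scalar; last first.
    move=> a c c' /=; rewrite mulmxDl -scalemxAl linearP /= mulmxDr -scalemxAr.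
    by rewrite linearP.
  congr (if _ then _ else _).
  have -> : (alpha *m C^T == 0) = (alpha *m (row_base C)^T == 0).
    by rewrite !mulmx_tr_eq0 eq_row_base.
  apply/forallP/idP => [tr0 | /eqP aB0 c]; last first.
    by rewrite trmx_mul mulmxA aB0 mul0mx mxtrace0.
  apply: contraT => /mxtrace_nondegenerate[Y].
  rewrite mxtrace_mulC => /negPf; have := tr0 Y^T.
  by rewrite trmx_mul trmxK mulmxA => ->.
by move=> x _; case: (x <= C)%MS; rewrite ?mul1r ?mul0r.
Qed.

(** Once the sums are exchanged, summing over the code kills each nonzero [x] in the support of [a],
    because the character is nontrivial there. *)
Lemma poisson_mrd n l k (enc : {linear 'M[F]_(k, l) -> 'M[F]_(l, n)})
    (a : LPvar R F n l) :
    (forall x, x != 0 -> a x != 0 -> exists c, \tr (enc c *m x^T) != 0) ->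
  \sum_c fourier a (enc c) = (#|F| ^ (k * l))%:R * (a 0)%:C.
Proof.
move=> supp_a; rewrite /fourier exchange_big /= (bigD1 0) //=.
rewrite [X in _ + X]big1 ?addr0 => [|x x_neq0].
  rewrite -mulr_sumr mulrC; congr (_ * _).
  rewrite (eq_bigr (fun=> 1)) => [|c _]; first by rewrite sumr_const card_mx.
  by rewrite tuple_charE trmx0 mulmx0 mxtrace0 trace_char0.
have [->|/(supp_a _ x_neq0) [c tr_neq0]] := eqVneq (a x) 0.
  by rewrite big1 // => c _; rewrite mul0r.
rewrite -mulr_sumr; under eq_bigr do rewrite tuple_charE.
rewrite (@sum_trace_char_scalar _ _ (fun c => \tr (enc c *m x^T))).
  by case: forallP => [/(_ c) /idPn|]; rewrite ?mulr0 // tr_neq0.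
by move=> b c1 c2; rewrite linearP /= mulmxDl -scalemxAl linearP.
Qed.
End Fourier.

(** * The optimum value *)

Section Codes.
Variables (F : finFieldType) (n : nat).

Definition vspace_of_mx (C : 'M[F]_n) : {vspace 'rV[F]_n} :=
  limg (linfun (mulmxr C)).

Lemma mem_vspace_of_mx C w : (w \in vspace_of_mx C) = (w <= C)%MS.
Proof.
apply/memv_imgP/submxP => [[u _ ->] | [u ->]]; first by exists u; rewrite lfunE.
by exists u; rewrite ?memvf // lfunE.
Qed.

Lemma mx_of_vspace (V : {vspace 'rV[F]_n}) :
  exists C : 'M[F]_n, forall w, (w \in V) = (w <= C)%MS.
Proof.
exists (lin1_mx (projv V)) => w; apply/idP/submxP => [wV | [u ->]].
  by exists w; rewrite mul_rV_lin1 /= projv_id.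
by rewrite mul_rV_lin1 /= memv_proj.
Qed.

(** Boolean, and on a finite type, so that a code of largest rank can be selected. *)
Definition code_mx d (C : 'M[F]_n) : bool :=
  [forall w : 'rV[F]_n, (w <= C)%MS ==> ~~ low_weight d w].

Lemma min_dist_ge_mx d (C : 'M[F]_n) (V : {vspace 'rV[F]_n}) :
  (forall w, (w \in V) = (w <= C)%MS) -> min_dist_ge d V <-> code_mx d C.
Proof.
move=> VC; split=> [dV | /forallP dC w].
  by apply/forallP => w; apply/implyP; rewrite -VC => /dV.
by rewrite VC; apply/implyP.
Qed.

Lemma max_code d : exists C0 : 'M[F]_n,
  code_mx d C0 /\ forall C : 'M[F]_n, code_mx d C -> (\rank C <= \rank C0)%N.
Proof.
have code0 : code_mx d (0 : 'M[F]_n).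
  apply/forallP => w; apply/implyP; rewrite submx0 => /eqP->.
  rewrite /low_weight (_ : hweight 0 = 0%N) //.
  by apply: eq_card0 => i; rewrite inE mxE eqxx.
by case: (arg_maxnP (fun C : 'M[F]_n => \rank C) code0) => C0 dC0 maxC0; exists C0.
Qed.

Lemma ALinE d (C0 : 'M[F]_n) : code_mx d C0 ->
    (forall C : 'M[F]_n, code_mx d C -> (\rank C <= \rank C0)%N) ->
  ALin F n d = (#|F| ^ \rank C0)%N.
Proof.
move=> dC0 maxC0; apply/eqP; rewrite eqn_leq; apply/andP; split.
  apply/bigmax_leqP => S /asboolP[V -> dV].
  have [C VC] := mx_of_vspace V.
  rewrite (_ : [set w in V]%SET = [set w : 'rV[F]_n | (w <= C)%MS]%SET).
    by rewrite card_rowspace leq_exp2l ?finNzRing_gt1 // maxC0 // -(min_dist_ge_mx d VC).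
  by apply/setP => w; rewrite !inE VC.
rewrite -card_rowspace; apply: (leq_bigmax_cond (F := fun S : {set 'rV[F]_n} => #|S|)).
apply/asboolP; exists (vspace_of_mx C0).
  by apply/setP => w; rewrite !inE mem_vspace_of_mx.
by apply/(min_dist_ge_mx d (mem_vspace_of_mx C0)).
Qed.
End Codes.

Section Optimum.
Variables (R : realType) (F : finFieldType) (n d l : nat).
Local Notation LP := (LPvar R F n l).
Hypothesis l_gt0 : (0 < l)%N.
Hypothesis le_nl : (n <= l)%N.

Lemma true_solutionE C (x : 'M[F]_(l, n)) :
  true_solution R (vspace_of_mx C) x = (x <= C)%MS%:R.
Proof.
rewrite /true_solution; congr (_%:R); congr nat_of_bool.
apply/forallP/row_subP => xC i; first by rewrite -mem_vspace_of_mx.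
by rewrite mem_vspace_of_mx.
Qed.

Definition mx_solution (C : 'M[F]_n) : LP := fun x => (x <= C)%MS%:R.

Lemma objective_mx_solution C :
  objective (mx_solution C) = (#|F| ^ (l * \rank C))%:R.
Proof.
rewrite /objective /mx_solution -natr_sum -big_mkcond /= (big_rowspace _ C).
by rewrite sum1_card card_mx.
Qed.

Lemma feasible_mx_solution C : code_mx d C -> feasible d (mx_solution C).
Proof.
move=> /forallP dC; split=> [|x [w wx low_w]|alpha|x|x]; rewrite /mx_solution.
- by rewrite sub0mx.
- case: (boolP (x <= C)%MS) => // xC; have := dC w.
  by rewrite (submx_trans wx xC) low_w.
- by rewrite -/(fourier _ _) fourier_rowspace; case: ifP => // _; apply: ler0n.
- by rewrite eqmx_opp.
- exact: ler0n.
Qed.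

Variables (C0 : 'M[F]_n).
Hypothesis dC0 : code_mx d C0.
Hypothesis maxC0 : forall C : 'M[F]_n, code_mx d C -> (\rank C <= \rank C0)%N.
Local Notation k := (\rank C0).

(** By maximality of k, a row space of larger dimension contains a word of low weight, and the
    distance constraint applies. *)
Lemma feasible_rank_le (a : LP) x : feasible d a -> a x != 0 -> (\rank x <= k)%N.
Proof.
move=> fa; apply: contraNleq; rewrite ltnNge => gt_xk.
have : ~~ code_mx d <<x>>%MS.
  by apply: contra gt_xk => /maxC0; rewrite genmxE.
rewrite negb_forall => /existsP[w]; rewrite negb_imply negbK genmxE => /andP[wx low_w].
by apply/eqP/(feas_dist fa); exists w.
Qed.

Lemma feasible_mrd_sum (a : LP) (enc : {linear 'M[F]_(k, l) -> 'M[F]_(l, n)}) :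
    feasible d a -> (forall c, c != 0 -> (n - k < \rank (enc c))%N) ->
  \sum_c fourier a (enc c) = (#|F| ^ (k * l))%:R.
Proof.
move=> fa rank_enc; rewrite poisson_mrd ?(feas_norm fa) ?mulr1 // => x x_neq0 ax_neq0.
by apply: mrd_dual rank_enc x_neq0 _; rewrite ?rank_leq_row // (feasible_rank_le fa).
Qed.

Lemma feasible_mrd_split (a : LP) (enc : {linear 'M[F]_(k, l) -> 'M[F]_(l, n)}) :
    feasible d a -> (forall c, c != 0 -> (n - k < \rank (enc c))%N) ->
  (objective a)%:C + \sum_(c | c != 0) fourier a (enc c) = ((#|F| ^ (k * l))%:R)%:C.
Proof.
move=> fa rank_enc; have := feasible_mrd_sum fa rank_enc.
by rewrite (bigD1 0) //= linear0 fourier0 => ->; rewrite rmorph_nat.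
Qed.

Lemma objective_le (a : LP) : feasible d a -> objective a <= (#|F| ^ (k * l))%:R.
Proof.
move=> fa; have [|enc [rank_enc _]] := @mrd_code F l n k 0 l_gt0.
  by rewrite rank_leq_row.
rewrite -lecR -(feasible_mrd_split fa rank_enc) lerDl sumr_ge0 // => c _.
exact: feas_four fa _.
Qed.

Lemma objective_optimal (a : LP) : optimal d a -> objective a = (#|F| ^ (k * l))%:R.
Proof.
case=> fa opt_a; apply/eqP; rewrite eq_le objective_le //=.
have := opt_a _ (feasible_mx_solution dC0).
by rewrite objective_mx_solution mulnC.
Qed.

Lemma fourier_optimal (a : LP) alpha :
  optimal d a -> (n - k < \rank alpha)%N -> fourier a alpha = 0.
Proof.
move=> opt_a lt_alpha; have fa := opt_a.1.
have [|enc [rank_enc /(_ lt_alpha)[c enc_c]]] := @mrd_code F l n k alpha l_gt0.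
  by rewrite rank_leq_row.
(* The objective already accounts for the whole total, so the nonnegative terms at nonzero [c] add
   up to 0. *)
have := feasible_mrd_split fa rank_enc.
rewrite objective_optimal // => /eqP; rewrite -subr_eq0 addrAC subrr add0r.
rewrite psumr_eq0 => [/allP/(_ c)|c' _]; last exact: feas_four fa _.
rewrite mem_index_enum enc_c => /(_ isT)/implyP sum0; apply/eqP/sum0.
(* The rank bound makes [alpha] nonzero, hence [c] is not the excluded index 0. *)
apply: contraTneq lt_alpha => c0.
by rewrite -enc_c c0 linear0 mxrank0.
Qed.

Lemma LPvalE : LPval R F n d l = ((#|F| ^ (k * l))%:R)%:E.
Proof.
apply/eqP; rewrite eq_le; apply/andP; split.
  by apply: ge_ereal_sup => _ [a fa <-]; rewrite lee_fin objective_le.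
apply: ereal_sup_ubound; exists (mx_solution C0).
  exact: feasible_mx_solution.
by rewrite objective_mx_solution mulnC.
Qed.
End Optimum.

(** * Integrality *)

Section Decomposition.
Variables (R : realType) (F : finFieldType) (n l : nat).
Local Notation LP := (LPvar R F n l).
Hypothesis le_nl : (n <= l)%N.

(** When n <= l, these are the rows of [C] followed by zero rows. *)
Definition spanning_tuple (C : 'M[F]_n) : 'M[F]_(l, n) := pid_mx n *m C.

Lemma spanning_tupleE C : (spanning_tuple C :=: C)%MS.
Proof. by apply: eqmxMfull; rewrite /row_full rank_pid_mx. Qed.

Lemma GL_invariant_eqmx (a : LP) x y : GL_invariant a -> (x == y)%MS -> a x = a y.
Proof.
move=> inv_a /eqmxMunitP[P uP ->]; rewrite -[P]trmxK inv_a //.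
by rewrite unitmx_tr.
Qed.

Lemma genmx_le_rank_eq (C D : 'M[F]_n) : <<C>>%MS = C -> <<D>>%MS = D ->
  (C <= D)%MS -> (\rank D <= \rank C)%N -> C = D.
Proof.
move=> gC gD leCD ge_rank; rewrite -gC -gD; apply/genmxP.
by rewrite -(geq_leqif (mxrank_leqif_eq leCD)).
Qed.

(* Subspaces are represented by the square matrices fixed by [<<_>>]; the weights
   on the top rank are subtracted off and the rest is handled by induction. *)
Lemma GL_invariant_decomposition r (a : LP) :
    GL_invariant a -> (forall x, (r <= \rank x)%N -> a x = 0) ->
  exists w : 'M[F]_n -> R,
    [/\ forall C, <<C>>%MS != C -> w C = 0,
        forall C, (r <= \rank C)%N -> w C = 0
      & forall x, a x = \sum_C w C * mx_solution R C x].
Proof.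
elim: r a => [|r IHr] b inv_b b0.
  exists (fun=> 0); split=> // x; rewrite b0 // big1 // => C _.
  by rewrite mul0r.
pose w0 C := if (<<C>>%MS == C) && (\rank C == r) then b (spanning_tuple C) else 0.
pose b' : LP := fun x => b x - \sum_C w0 C * mx_solution R C x.
have inv_b' : GL_invariant b'.
  move=> M x uM; rewrite /b' inv_b //; congr (_ - _); apply: eq_bigr => C _.
  by rewrite /mx_solution (eqmxMfull x) // row_full_unit unitmx_tr.
have b'0 x : (r <= \rank x)%N -> b' x = 0.
  move=> le_rx; apply/eqP; rewrite subr_eq0; apply/eqP.
  have gx : <<<<x>>>>%MS = <<x>>%MS by rewrite genmx_id.
  (* As [x] has rank at least r, the only r-dimensional space that can contain its rows is its own
     row space. *)
  have w0x C : C != <<x>>%MS -> w0 C * mx_solution R C x = 0.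
    rewrite /w0 /mx_solution; case: ifP; rewrite ?mul0r // => /andP[/eqP gC /eqP rC].
    case: (boolP (x <= C)%MS); rewrite ?mulr0 // => leCx /eqP[].
    by apply/esym/genmx_le_rank_eq; rewrite ?genmxE ?rC.
  rewrite (bigD1 <<x>>%MS) //= big1 ?addr0; last by move=> C; apply: w0x.
  rewrite /mx_solution genmxE submx_refl mulr1 /w0 gx eqxx genmxE /=.
  have [rx|rx] := eqVneq (\rank x) r.
    by apply: GL_invariant_eqmx => //; rewrite !spanning_tupleE // !genmxE submx_refl.
  by rewrite b0 // ltn_neqAle eq_sym rx.
have [w [w_gen w_large b'E]] := IHr b' inv_b' b'0.
exists (fun C => w0 C + w C); split=> [C gC | C lt_rC | x].
  by rewrite w_gen // /w0 (negPf gC) addr0.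
  by rewrite w_large ?(ltnW lt_rC) // /w0 gtn_eqF // andbF addr0.
under eq_bigr do rewrite mulrDl.
by rewrite big_split /= -b'E /b' addrC subrK.
Qed.
End Decomposition.

Section Integrality.
Variables (R : realType) (F : finFieldType) (n d l : nat).
Hypothesis l_gt0 : (0 < l)%N.
Hypothesis le_nl : (n <= l)%N.

Lemma fourier_decomposition (a : LPvar R F n l) (w : 'M[F]_n -> R) alpha :
    (forall x, a x = \sum_C w C * mx_solution R C x) ->
  fourier a alpha =
    \sum_C (w C)%:C * (if alpha *m C^T == 0 then (#|F| ^ (l * \rank C))%:R else 0).
Proof.
move=> aE; rewrite /fourier.
under eq_bigr => x _ do rewrite aE rmorph_sum mulr_suml.
rewrite exchange_big; apply: eq_bigr => C _ /=.
rewrite -fourier_rowspace /fourier mulr_sumr; apply: eq_bigr => x _.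
by rewrite rmorphM mulrA.
Qed.

Lemma optimal_integral (a : LPvar R F n l) :
  optimal d a -> GL_invariant a -> integral_solution a.
Proof.
move=> opt_a inv_a; have fa := opt_a.1.
have [C0 [dC0 maxC0]] := max_code F n d.
have [|w [w_gen w_large aE]] := GL_invariant_decomposition le_nl (r := (\rank C0).+1) inv_a.
  move=> x; rewrite ltnNge => gt_xk; apply/eqP/negPn.
  by apply: contra gt_xk => /(feasible_rank_le maxC0 fa).
have w_small r C : (\rank C < r)%N -> (\rank C < \rank C0)%N -> w C = 0.
  elim: r C => // r IHr C le_Cr lt_Ck.
  have [gC|/w_gen//] := eqVneq <<C>>%MS C.
  (* This tuple spans the orthogonal of [C]; its rank n - dim C exceeds n - k, so the transform
     vanishes there. *)
  pose alpha := spanning_tuple l (cokermx C)^T.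
  have alphaE D : (alpha *m D^T == 0) = (D <= C)%MS.
    by rewrite -trmx_eq0 trmx_mul trmxK mulmx_tr_eq0 spanning_tupleE //
      -mulmx_tr_eq0 trmxK submxE.
  have : fourier a alpha = 0.
    apply: (fourier_optimal l_gt0 le_nl dC0 maxC0 opt_a).
    rewrite spanning_tupleE // mxrank_tr mxrank_coker.
    by have := rank_leq_col C0; lia.
  rewrite (fourier_decomposition _ aE) (bigD1 C) //= big1 => [|D nD].
    rewrite alphaE submx_refl addr0 => /eqP; rewrite mulf_eq0 pnatr_eq0.
    rewrite expn_eq0 eqn0Ngt (ltnW (finNzRing_gt1 F)) orbF => /eqP.
    by move/(congr1 (@complex.Re R)).
  (* Only subspaces of [C] contribute, and the proper ones have weight 0 by induction. *)
  rewrite alphaE; case: (boolP (D <= C)%MS) => [leDC|]; last by rewrite mulr0.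
  have [gD|/w_gen->] := eqVneq <<D>>%MS D; last by rewrite mul0r.
  have lt_DC : (\rank D < \rank C)%N.
    rewrite ltnNge; apply: contra nD => ge_D.
    by rewrite (genmx_le_rank_eq gD gC leDC ge_D).
  by rewrite IHr ?mul0r //; lia.
have w_ge0 C : 0 <= w C.
  have [gC|/w_gen->] := eqVneq <<C>>%MS C; last exact: lexx.
  case: (ltngtP (\rank C) (\rank C0)) => [|/w_large->|rC]; rewrite ?lexx //.
    by move/(w_small _ _ (ltnSn _))->.
  (* A space of dimension at most k containing [C], itself of dimension k, is [C], so this value of
     [a] is [w C]. *)
  have := feas_nneg fa (spanning_tuple l C).
  rewrite aE (bigD1 C) //= big1 => [|D nD].
    by rewrite addr0 /mx_solution (spanning_tupleE le_nl) submx_refl mulr1.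
  rewrite /mx_solution (spanning_tupleE le_nl).
  have [gD|/w_gen->] := eqVneq <<D>>%MS D; last by rewrite mul0r.
  case: (boolP (C <= D)%MS) => [leCD|]; last by rewrite mulr0.
  have [le_DC|/w_large->] := leqP (\rank D) (\rank C0); last by rewrite mul0r.
  by rewrite (@genmx_le_rank_eq _ _ C D) ?rC ?eqxx // in nD.
exists #|{: 'M[F]_n}|, (fun i => vspace_of_mx (enum_val i)), (fun i => w (enum_val i)).
split=> [i||x]; first exact: w_ge0.
  (* The zero tuple lies in every code, so the weights sum to the value of [a] at 0. *)
  rewrite -(feas_norm fa) aE [RHS](reindex _ (onW_bij _ (@enum_val_bij _))) /=.
  by apply: eq_bigr => i _; rewrite /mx_solution sub0mx mulr1.
rewrite aE (reindex _ (onW_bij _ (@enum_val_bij _))) /=.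
by apply: eq_bigr => i _; rewrite true_solutionE.
Qed.
End Integrality.

Theorem theorem3p5 (R : realType) (F : finFieldType) (n d l : nat)
    (n_gt0 : (0 < n)%N) (d_gt0 : (0 < d)%N) (l_gt0 : (0 < l)%N)
    (le_nl : (n <= l)%N) :
  (((ALin F n d)%:R : R)%:E = LPval R F n d l `^ (l%:R^-1)%R)%E /\
  (forall a : LPvar R F n l,
     optimal d a -> GL_invariant a -> integral_solution a).
Proof.
split; last by move=> a; apply: optimal_integral.
have [C0 [dC0 maxC0]] := max_code F n d.
rewrite (ALinE dC0 maxC0) (LPvalE R l_gt0 le_nl dC0 maxC0) poweR_EFin.
(* The exponent is regrouped so that the value is the l-th power of [N], the size of a largest
   code. *)
congr (_%:E); rewrite expnM; move: (#|F| ^ _)%N => N.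
rewrite natrX -powR_mulrn ?ler0n // -powRrM.
by rewrite divff ?powRr1 ?ler0n // pnatr_eq0 -lt0n.
Qed.
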